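(* Let $\mathcal{Y}=\{1,\dots,K\}$, let $f:\mathcal{X}\to\Delta_K$ be a fixed probabilistic predictor, and let $\Delta_K=B_1\cup\cdots\cup B_M$ be a partition into disjoint bins, $\mathcal{M}=\{1,\dots,M\}$, with bin-mapping $g:\mathcal{X}\to\mathcal{M}$, $g(x)=m$ iff $f(x)\in B_m$. Let $(X_1,Y_1),\dots,(X_n,Y_n)$ be i.i.d. from a distribution $P$ on $\mathcal{X}\times\mathcal{Y}$, and let $(X,Y)\sim P$ be independent of them. For $m\in\mathcal{M}$ and $y\in\mathcal{Y}$ let $\pi^P_{y,m}=\mathbb{P}(Y=y\mid f(X)\in B_m)$, $N_m=|\{i: f(X_i)\in B_m\}|$, $\widehat{\pi}^P_{y,m}=\frac1{N_m}\sum_{i=1}^n\mathbf{1}\{Y_i=y,f(X_i)\in B_m\}$, and write $\pi^P_m=(\pi^P_{1,m},\dots,\pi^P_{K,m})^\top$, $\widehat{\pi}^P_m=(\widehat{\pi}^P_{1,m},\dots,\widehat{\pi}^P_{K,m})^\top$. Let $h:\mathcal{X}\to\Delta_K$, $h(x)=\widehat{\pi}^P_{g(x)}$. Fix $\alpha\in(0,1)$ and set $$\varepsilon_m=\frac{2}{\sqrt{N_m}}\sqrt{\frac12\ln\Big(\frac{M2^K}{\alpha}\Big)}.$$ Then with probability at least $1-\alpha$ (over the calibration data), $\|\widehat{\pi}^P_m-\pi^P_m\|_1\le\varepsilon_m$ simultaneously for all $m\in\mathcal{M}$. As a consequence, with probability at least $1-\alpha$, $$\sum_{y=1}^K\big|\mathbb{P}(Y=y\mid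 h(X)=z)-z_y\big|\le\max_{m\in\mathcal{M}}\varepsilon_m$$ simultaneously for all $z$ in the range of $h$.
   Context: $\Delta_K$ denotes the probability simplex in $\mathbb{R}^K$, and $z_y$ is the $y$-th coordinate of $z\in\Delta_K$. *)

(* Defs.v *)
From HB Require Import structures.
From mathcomp Require Import all_boot all_order all_algebra.
From mathcomp Require Import all_classical all_reals all_analysis.
Set Implicit Arguments. Unset Strict Implicit. Unset Printing Implicit Defensive.
Import Order.TTheory GRing.Theory Num.Theory.
Local Open Scope classical_set_scope.
Local Open Scope ring_scope.

Section Defs.
Context {R : realType}.

Definition simplex (K : nat) : set ('I_K -> R) :=
  [set z | (forall y, 0 <= z y) /\ \sum_(y < K) z y = 1].

Definition probR {d} {T : measurableType d} (Q : probability T R) (A : set T) : R :=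
  fine (Q A).

(* Elementary conditional probability P(A | B) = P(A /\ B) / P(B)
   (mathcomp convention: value 0 when P(B) = 0). *)
Definition condprobR {d} {T : measurableType d} (Q : probability T R) (A B : set T) : R :=
  probR Q (A `&` B) / probR Q B.

(* The family of n calibration pairs followed (at index n) by the test pair. *)
Definition extend_rv {T U : Type} {n : nat} (Zs : 'I_n -> T -> U) (Z : T -> U)
  : 'I_n.+1 -> T -> U :=
  fun i => if unlift ord_max i is Some j then Zs j else Z.

(* (Z i, W i)_{i<N} are i.i.d. random pairs with values in TX x 'I_K:
   mutual independence (product rule on all measurable rectangles, which
   generate the product sigma-algebra; the label space is discrete) and
   identical distribution. *)
Definition iid_pairs {d dX} {Omega : measurableType d} {TX : measurableType dX}
  {K N : nat} (Q : probability Omega R)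
  (Z : 'I_N -> Omega -> TX) (W : 'I_N -> Omega -> 'I_K) : Prop :=
  (forall (A : 'I_N -> set TX) (C : 'I_N -> set 'I_K),
     (forall i, measurable (A i)) ->
     probR Q [set w | forall i, A i (Z i w) /\ C i (W i w)] =
     \prod_(i < N) probR Q [set w | A i (Z i w) /\ C i (W i w)]) /\
  (forall (i j : 'I_N) (A : set TX) (C : set 'I_K), measurable A ->
     probR Q [set w | A (Z i w) /\ C (W i w)] =
     probR Q [set w | A (Z j w) /\ C (W j w)]).

Definition bin_count {Omega TX : Type} {n M : nat} (g : TX -> 'I_M)
  (Xs : 'I_n -> Omega -> TX) (m : 'I_M) (w : Omega) : nat :=
  #|[set i : 'I_n | g (Xs i w) == m]|.

Definition pihat {Omega TX : Type} {n M K : nat} (g : TX -> 'I_M)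
  (Xs : 'I_n -> Omega -> TX) (Ys : 'I_n -> Omega -> 'I_K)
  (w : Omega) (m : 'I_M) (y : 'I_K) : R :=
  (#|[set i : 'I_n | (Ys i w == y) && (g (Xs i w) == m)]|)%:R
    / (bin_count g Xs m w)%:R.

Definition piPbin {d dX} {Omega : measurableType d} {TX : measurableType dX}
  {M K : nat} (Q : probability Omega R) (g : TX -> 'I_M)
  (X : Omega -> TX) (Y : Omega -> 'I_K) (m : 'I_M) (y : 'I_K) : R :=
  condprobR Q [set w | Y w = y] [set w | g (X w) = m].

Definition eps_bin (M K : nat) (alpha : R) (Nm : nat) : \bar R :=
  if Nm == 0%N then +oo%E
  else (2 / Num.sqrt (Nm%:R) * Num.sqrt (2^-1 * ln (M%:R * 2 ^+ K / alpha)))%:E.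

End Defs.

(* Main.v *)
(** Only the finite-valued pairs (g X_i, Y_i) matter, and they are i.i.d. with
    law [mu] on bins times labels, so the statement reduces to a bound on
    product weights over [{ffun 'I_n -> 'I_M * 'I_K}].  For a bin [m] and a set
    [A] of labels, splitting according to the set [I] of indices that fall in
    the bin makes the deviation threshold and the Chernoff parameter functions
    of [#|I|] only; Hoeffding's bound for each [I], summed over [I], gives
    [exp (- ln (M 2^K / alpha))].  The l1 distance of two probability vectors is
    twice their largest difference over label sets, and the union bound over the
    [2^K] label sets and the [M] bins gives [alpha].  Given [h X = z], the law of
    [Y] is a mixture of the bin-conditional laws over the bins with empirical
    vector [z], so the second claim holds on the same event by convexity; bins of
    probability zero are discarded because they are almost surely empty, while
    empty bins have infinite threshold. *)
Require Import Defs.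
From HB Require Import structures.
From mathcomp Require Import all_boot all_order all_algebra.
From mathcomp Require Import all_classical all_reals all_analysis.
From mathcomp Require Import ring lra.
Import Order.TTheory GRing.Theory Num.Theory.
Import numFieldNormedType.Exports.
Set Implicit Arguments. Unset Strict Implicit. Unset Printing Implicit Defensive.
Local Open Scope ring_scope.

Section FiniteConcentration.
Variable R : realType.

(** * Hoeffding's lemma for a Bernoulli variable *)

Lemma le_origin_of_derive_le0 (F dF : R -> R) (x : R) :
  (forall t : R, is_derive t 1 F (dF t)) -> (forall t, 0 <= t -> dF t <= 0) ->
  0 <= x -> F x <= F 0.
Proof.
move=> FdF dF_le0 x_ge0; apply: (@ler0_derive1_nincry _ F 0) => // [t|].
- rewrite in_itv/= andbT => t_gt0; rewrite derive1E.
  by have [_ ->] := FdF t; rewrite dF_le0// ltW.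
- apply: continuous_subspaceT => t.
  by apply/differentiable_continuous/derivable1_diffP; have [] := FdF t.
Qed.

(** With [G] the moment generating function of the uncentered law, the product of [G t] and
    [expR (- (t * p) - t ^+ 2 / 8)] has logarithmic derivative [u t - (p + t / 4)], nonpositive for
    [t >= 0]; so the product stays below its value 1 at the origin. *)
Lemma centered_bernoulli_mgf_le (p l : R) : 0 <= p <= 1 -> 0 <= l ->
  p * expR (l * (1 - p)) + (1 - p) * expR (l * - p) <= expR (l ^+ 2 / 8).
Proof.
move=> /andP[p_ge0 p_le1] l_ge0.
pose G (t : R) : R := 1 - p + p * expR t.
have GE t : G t = 1 - p + p * expR t by [].
have G_gt0 t : 0 < G t.
  rewrite GE; have := expR_gt0 t; case: (ltrP p 1) => ? ?.
    have := mulr_ge0 p_ge0 (expR_ge0 t); lra.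
  have -> : p = 1 by lra.
  lra.
have dG (t : R) : is_derive t 1 G (p * expR t).
  by rewrite /G; apply: trigger_derive; rewrite add0r mul1r.
(* [u t] is the mean of the Bernoulli law tilted by [t]; its derivative is the
   tilted variance, at most 1/4. *)
pose u (t : R) : R := 1 - (1 - p) / G t.
have u_le t : 0 <= t -> u t <= p + t / 4.
  move=> t_ge0.
  rewrite -subr_le0.
  have -> : 0 = u 0 - (p + 0 / 4) by rewrite /u GE expR0 mulr1 subrK divr1; ring.
  apply: (le_origin_of_derive_le0 (F := fun s => u s - (p + s / 4))
    (dF := fun s => (1 - p) * (p * expR s) / G s ^+ 2 - 1 / 4)) => // s.
    have dV := is_deriveV (lt0r_neq0 (G_gt0 s)) (dG s).
    rewrite /u; apply: trigger_derive; rewrite /GRing.scale/=.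
    by field; rewrite lt0r_neq0.
  move=> _; rewrite subr_le0 ler_pdivrMr ?exprn_gt0//.
  rewrite GE -subr_ge0.
  (* With [a = 1 - p] and [b = p * expR s] this is [(a + b)^2 / 4 - a b = (a - b)^2 / 4], the bound
     1/4 on the tilted variance. *)
  have -> : 1 / 4 * (1 - p + p * expR s) ^+ 2 - (1 - p) * (p * expR s) =
    (1 - p - p * expR s) ^+ 2 / 4 by field.
  by rewrite divr_ge0 ?sqr_ge0.
pose E (t : R) : R := expR (- (t * p) - t ^+ 2 / 8).
have key : G l * E l <= G 0 * E 0.
  apply: (le_origin_of_derive_le0 (F := fun s => G s * E s)
    (dF := fun s => E s * G s * (u s - (p + s / 4)))) => // s.
    have dE : is_derive s 1 E (E s * - (p + s / 4)).
      rewrite /E; apply: trigger_derive.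
      by rewrite /GRing.scale/=; field.
    apply: trigger_derive; rewrite /GRing.scale/= /u GE.
    by have := G_gt0 s; rewrite GE => G0; field; exact: lt0r_neq0.
  move=> s_ge0; rewrite mulr_ge0_le0 ?mulr_ge0 ?expR_ge0 ?subr_le0 ?u_le//.
  exact: ltW.
have {key} : G l * E l <= 1.
  apply: le_trans key _; rewrite /E GE mul0r expr0n mul0r subr0 oppr0 !expR0; lra.
rewrite GE /E expRD mulrA (expRN (l ^+ 2 / 8)) ler_pdivrMr ?expR_gt0// mul1r.
by apply: le_trans; rewrite mulrBr mulr1 mulrN expRD mulrA -mulrDl addrC.
Qed.

(** * Chernoff and Hoeffding bounds for product weights *)

Section ProductWeights.
Variables (T : finType) (mu : T -> R).
Hypotheses (mu_ge0 : forall t, 0 <= mu t) (mu_sum1 : \sum_t mu t = 1).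

Let mass (D : {set T}) := \sum_(t in D) mu t.

(** Hoeffding's lemma for the indicator of [A] under [mu] conditioned on [D], multiplied through by
    [mass D] so that it also holds, with [p = 0], when that mass vanishes. *)
Lemma weighted_mgf_le (D A : {set T}) (l : R) : 0 <= l ->
  \sum_(t in D) mu t * expR (l * ((t \in A)%:R - mass (D :&: A) / mass D)) <=
  mass D * expR (l ^+ 2 / 8).
Proof.
move=> l_ge0; set p := _ / _.
have mass_ge0 E : 0 <= mass E by apply: sumr_ge0.
have massD : mass D = mass (D :&: A) + mass (D :\: A) by exact: big_setID.
have pD : p * mass D = mass (D :&: A).
  rewrite /p; have [d0|d0] := eqVneq (mass D) 0; last by rewrite divfK.
  by apply/eqP; rewrite d0 mulr0 eq_le mass_ge0/= -d0 massD lerDl.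
have p01 : 0 <= p <= 1.
  rewrite /p divr_ge0//=; have [->|d0] := eqVneq (mass D) 0.
    by rewrite invr0 mulr0 ler01.
  by rewrite ler_pdivrMr ?mul1r ?massD ?lerDl// -massD lt0r d0/=.
rewrite (big_setID A)/=.
rewrite (eq_bigr (fun t => mu t * expR (l * (1 - p)))); last first.
  by move=> t; rewrite inE => /andP[_ ->].
rewrite [X in _ + X](eq_bigr (fun t => mu t * expR (l * - p))); last first.
  by move=> t; rewrite inE => /andP[/negPf-> _]; rewrite sub0r.
rewrite -!mulr_suml -/(mass (D :&: A)) -/(mass (D :\: A)).
have -> : mass (D :\: A) = (1 - p) * mass D by rewrite mulrBl pD mul1r massD; ring.
rewrite -pD.
have := ler_wpM2l (mass_ge0 D) (centered_bernoulli_mgf_le p01 l_ge0).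
apply: le_trans; rewrite le_eqVlt; apply/orP; left; apply/eqP; ring.
Qed.

(* Chernoff bound on the event that the indices falling in [D] are exactly [I];
   summing over [I] replaces conditioning on the random bin count. *)
Lemma chernoff_fixed_indices n (D A : {set T}) (I : {set 'I_n}) (l s : R) : 0 <= l ->
  \sum_(c : {ffun 'I_n -> T} | ([set i | c i \in D] == I) &&
      (s < \sum_(i in I) ((c i \in A)%:R - mass (D :&: A) / mass D))) \prod_i mu (c i)
  <= expR (#|I|%:R * (l ^+ 2 / 8) - l * s) *
     \prod_i (if i \in I then mass D else mass (~: D)).
Proof.
move=> l_ge0; set p := _ / _.
(* One factor per index, tilted inside [I] and restricted to [D] or its complement, so that the sum
   of the products over all [c] factors. *)
pose w (i : 'I_n) (t : T) : R := if i \in I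
  then (t \in D)%:R * (mu t * expR (l * ((t \in A)%:R - p)))
  else (t \notin D)%:R * mu t.
have w_ge0 i t : 0 <= w i t.
  by rewrite /w; case: ifP => _; rewrite !mulr_ge0 ?expR_ge0.
have step : \sum_(c : {ffun 'I_n -> T}) \prod_i w i (c i) <=
    expR (#|I|%:R * (l ^+ 2 / 8)) * \prod_i (if i \in I then mass D else mass (~: D)).
  rewrite -(bigA_distr_bigA w).
  have -> : expR (#|I|%:R * (l ^+ 2 / 8)) =
      \prod_i (if i \in I then expR (l ^+ 2 / 8) else 1).
    by rewrite -big_mkcond/= big_const iter_mulr_1 mulrC -expRM_natr.
  rewrite -big_split/=; apply: ler_prod => i _; rewrite sumr_ge0//=.
  rewrite /w; case: ifP => _.
    apply: le_trans (_ : mass D * expR (l ^+ 2 / 8) <= _); last by rewrite mulrC.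
    apply: le_trans (weighted_mgf_le D A l_ge0).
    rewrite [leRHS]big_mkcond/=; apply: ler_sum => t _.
    by case: (t \in D); rewrite ?mul1r ?mul0r.
  rewrite mul1r /mass [leRHS]big_mkcond/=; apply: ler_sum => t _; rewrite inE.
  by case: (t \in D); rewrite ?mul1r ?mul0r.
rewrite expRD mulrAC.
apply: le_trans (ler_wpM2r (expR_ge0 _) step).
(* Markov's inequality: terms outside the event are nonnegative and are dropped, and on the event
   the exponential factor is at least 1. *)
rewrite mulr_suml [leRHS](bigID (fun c : {ffun 'I_n -> T} => ([set i | c i \in D] == I) &&
      (s < \sum_(i in I) ((c i \in A)%:R - p)))) /=.
rewrite -[leLHS]addr0 lerD//; last first.
  by apply: sumr_ge0 => c _; rewrite mulr_ge0 ?expR_ge0// prodr_ge0.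
apply: ler_sum => c /andP[/eqP cI sc].
have -> : \prod_i w i (c i) = \prod_i mu (c i) *
    expR (l * \sum_(i in I) ((c i \in A)%:R - p)).
  rewrite mulr_sumr (big_morph _ (@expRD R) (expR0 R)) [X in _ * X]big_mkcond/=.
  rewrite -big_split/=; apply: eq_bigr => i _; rewrite /w -cI inE.
  by case: (c i \in D); rewrite ?mul1r ?mulr1.
rewrite -mulrA -expRD ler_peMr ?prodr_ge0//.
by rewrite -[leLHS]expR0 ler_expR -mulrBr mulr_ge0// subr_ge0 ltW.
Qed.

(** The factor [expR (- L)] is the same for every index set, because the threshold scales with the
    root of [#|I|]. The remaining products, summed over all [I], expand
    [(mass D + mass (~: D)) ^+ n = 1], so the random count costs no extra factor. *)
Lemma hoeffding_random_count n (D A : {set T}) (L : R) : 0 <= L ->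
  \sum_(c : {ffun 'I_n -> T} | let I := [set i | c i \in D] in (0 < #|I|)%N &&
      (Num.sqrt (#|I|%:R * (L / 2)) <
       \sum_(i in I) ((c i \in A)%:R - mass (D :&: A) / mass D)))
    \prod_i mu (c i) <= expR (- L).
Proof.
move=> L_ge0; set p := _ / _.
rewrite (partition_big (fun c : {ffun 'I_n -> T} => [set i | c i \in D]) predT)//=.
have -> : expR (- L) = expR (- L) * \prod_(i < n) (mass D + mass (~: D)).
  rewrite big1 ?mulr1// => i _; rewrite -mu_sum1 [RHS](bigID (mem D))/=.
  by congr (_ + _); apply: eq_bigl => t; rewrite inE.
rewrite bigA_distr mulr_sumr; apply: ler_sum => I _.
have mass_ge0 E : 0 <= mass E by apply: sumr_ge0.
have rhs_ge0 : 0 <= expR (- L) * \prod_i (if i \in I then mass D else mass (~: D)).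
  by rewrite mulr_ge0 ?expR_ge0// prodr_ge0// => i _; case: ifP.
have [I0|I_gt0] := posnP #|I|.
  rewrite big_pred0// => c; case: eqP => [->|]; rewrite ?I0 ?andbF//.
have N_gt0 : (0 : R) < #|I|%:R by rewrite ltr0n.
set N : R := #|I|%:R.
pose s := Num.sqrt (N * (L / 2)).
(* Minimises [N * (l ^+ 2 / 8) - l * s]; the minimum is [- 2 * s ^+ 2 / N = - L]. *)
pose l := 4 * s / N.
have s_ge0 : 0 <= s by exact: sqrtr_ge0.
have s2 : s ^+ 2 = N * (L / 2) by rewrite sqr_sqrtr// mulr_ge0 ?divr_ge0.
have l_ge0 : 0 <= l by rewrite divr_ge0 ?mulr_ge0// ltW.
have -> : - L = N * (l ^+ 2 / 8) - l * s.
  have -> : L = 2 * s ^+ 2 / N by rewrite s2; field; exact: lt0r_neq0.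
  by rewrite /l; field; exact: lt0r_neq0.
apply: le_trans (chernoff_fixed_indices D A I s l_ge0).
rewrite le_eqVlt; apply/orP; left; apply/eqP; apply: eq_bigl => c.
by rewrite andbC; case: eqP => //= ->; rewrite I_gt0.
Qed.
End ProductWeights.

(** Adding the zero sum of [a] to the left side doubles the positive terms and cancels the
    others. *)
Lemma sum_norm_eq2_sum_pos (V : finType) (a : V -> R) : \sum_y a y = 0 ->
  \sum_y `|a y| = 2 * \sum_(y in [set y | 0 < a y]) a y.
Proof.
move=> a0.
transitivity (\sum_y `|a y| + \sum_y a y); first by rewrite a0 addr0.
rewrite -big_split/= [in RHS]big_mkcond mulr_sumr.
apply: eq_bigr => y _; rewrite inE; case: ltrgt0P => [_|_|->]; ring.
Qed.

Lemma sum_union_bound (C I : finType) (F : C -> R) (P : pred C) (S : I -> pred C) :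
  (forall c, 0 <= F c) -> (forall c, P c -> exists i, S i c) ->
  \sum_(c | P c) F c <= \sum_i \sum_(c | S i c) F c.
Proof.
move=> F_ge0 PS; rewrite (exchange_big_dep predT)//= [leLHS]big_mkcond/=.
apply: ler_sum => c _; case: ifP => [/PS[i Sic]|_]; last exact: sumr_ge0.
by rewrite (bigD1 i)//= lerDl sumr_ge0.
Qed.

(** * Empirical label frequencies in the bins *)

Section BinFrequencies.
Variables (J V : finType) (mu : J * V -> R).
Hypotheses (mu_ge0 : forall t, 0 <= mu t) (mu_sum1 : \sum_t mu t = 1).

(** A bin of mass zero gets the value 0, in agreement with [condprobR]. *)
Definition label_prob (m : J) (y : V) : R := mu (m, y) / \sum_y' mu (m, y').

Definition num_in_bin n (c : {ffun 'I_n -> J * V}) (m : J) : nat :=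
  #|[set i | (c i).1 == m]|.

Definition label_freq n (c : {ffun 'I_n -> J * V}) (m : J) (y : V) : R :=
  #|[set i | c i == (m, y)]|%:R / (num_in_bin c m)%:R.

Definition l1_dev n (c : {ffun 'I_n -> J * V}) (m : J) : R :=
  \sum_y `|label_freq c m y - label_prob m y|.

Let bin (m : J) : {set J * V} := [set t | t.1 == m].
Let lab (B : {set V}) : {set J * V} := [set t | t.2 \in B].

Lemma mass_bin_lab (m : J) (B : {set V}) :
  \sum_(t in bin m :&: lab B) mu t = \sum_(y in B) mu (m, y).
Proof.
transitivity (\sum_(m' | m' == m) \sum_(y in B) mu (m', y)).
  by rewrite pair_big_dep/=; apply: eq_big => [[m' y]|[]//]; rewrite !inE.
by rewrite big_pred1_eq.
Qed.

Lemma mass_bin (m : J) : \sum_(t in bin m) mu t = \sum_y mu (m, y).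
Proof.
transitivity (\sum_(m' | m' == m) \sum_y mu (m', y)).
  by rewrite pair_big_dep/=; apply: eq_big => [[m' y]|[]//]; rewrite !inE andbT.
by rewrite big_pred1_eq.
Qed.

Lemma natr_card (n : nat) (P : pred 'I_n) : #|[set i | P i]|%:R = \sum_i (P i)%:R :> R.
Proof.
rewrite -sum1_card natr_sum big_mkcond/=.
by apply: eq_bigr => i _; rewrite inE; case: (P i).
Qed.

(** Multiplying by the count keeps the identity valid for an empty bin and yields the indicator sums
    bounded in [hoeffding_random_count]. *)
Lemma sum_label_freq n (c : {ffun 'I_n -> J * V}) (m : J) (B : {set V}) :
  (num_in_bin c m)%:R * \sum_(y in B) label_freq c m y =
  \sum_(i in [set i | c i \in bin m]) (c i \in lab B)%:R.
Proof.
have [N0|N_gt0] := posnP (num_in_bin c m).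
  rewrite N0 mul0r big_pred0// => i; apply/negbTE/negP => iI.
  move/eqP: N0; rewrite cards_eq0 => /eqP/setP/(_ i).
  by rewrite !inE; move: iI; rewrite !inE => ->.
rewrite mulr_sumr (eq_bigr (fun y => \sum_i (c i == (m, y))%:R)); last first.
  by move=> y _; rewrite mulrC divfK ?pnatr_eq0 -?lt0n// natr_card.
rewrite exchange_big/= [RHS]big_mkcond/=; apply: eq_bigr => i _; rewrite !inE.
case: (c i) => m' y' /=.
under eq_bigr do rewrite xpair_eqE.
case: eqP => _ /=; last by rewrite big1.
rewrite big_mkcond (bigD1 y')//= eqxx big1 ?addr0; first by case: ifP.
by move=> y /negPf; rewrite eq_sym => ->; case: ifP.
Qed.

(** The bad event includes samples falling in a bin of mass zero: they have weight zero, and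
    excluding them is what allows pooling later. Otherwise the l1 deviation is twice the excess over
    one of the [2 ^+ #|V|] label sets, each contributing at most [expR (- L)]. *)
Lemma bin_deviation_bound n (m : J) (L : R) : 0 <= L ->
  \sum_(c : {ffun 'I_n -> J * V} | (0 < num_in_bin c m)%N &&
     ((\sum_y mu (m, y) == 0) ||
      (2 / Num.sqrt (num_in_bin c m)%:R * Num.sqrt (2^-1 * L) < l1_dev c m)))
    \prod_i mu (c i) <= 2 ^+ #|V| * expR (- L).
Proof.
move=> L_ge0.
have [d0|d_neq0] := eqVneq (\sum_y mu (m, y)) 0.
  rewrite big1 ?mulr_ge0 ?exprn_ge0 ?expR_ge0// => c /andP[/card_gt0P[i]].
  rewrite inE => /eqP cim _; rewrite (bigD1 i)//=.
  have -> : mu (c i) = 0; last by rewrite mul0r.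
  move: cim; case: (c i) => _ y /= ->.
  move/eqP: d0; rewrite psumr_eq0// => /allP/(_ y); rewrite mem_index_enum.
  by move=> /(_ isT)/eqP.
have F_ge0 (c : {ffun 'I_n -> J * V}) : 0 <= \prod_i mu (c i) by exact: prodr_ge0.
have -> : 2 ^+ #|V| * expR (- L) = \sum_(B : {set V}) expR (- L).
  rewrite sumr_const -[#|{: {set V}}|]cardsT -powersetT card_powerset cardsT.
  by rewrite -[RHS]mulr_natl natrX.
apply: le_trans (ler_sum _ (fun B _ =>
  hoeffding_random_count mu_ge0 mu_sum1 n (bin m) (lab B) L_ge0)).
apply: sum_union_bound => // c /=; move=> /andP[N_gt0 dev].
set N := num_in_bin c m in N_gt0 dev *.
have EI : [set i | c i \in bin m] = [set i | (c i).1 == m].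
  by apply/setP => i; rewrite !inE.
pose a y := label_freq c m y - label_prob m y.
(* The labels over-represented in the sample carry half of the l1 deviation. *)
exists [set y | 0 < a y]; rewrite EI N_gt0/=.
have NR : (0 : R) < N%:R by rewrite ltr0n.
have card_bin : \sum_(i in [set i | (c i).1 == m]) 1 = N%:R :> R.
  by rewrite sumr_const.
(* Both vectors sum to 1, since the bin is nonempty and has nonzero mass. *)
have suma : \sum_y a y = 0.
  have -> : \sum_y a y = \sum_y label_freq c m y - N%:R / N%:R.
    rewrite sumrB divff ?lt0r_neq0//; congr (_ - _).
    by rewrite /label_prob -mulr_suml divff.
  have -> : \sum_y label_freq c m y = \sum_(y in [set: V]) label_freq c m y.
    by apply: eq_bigl => y; rewrite inE.
  apply/eqP; rewrite subr_eq0; apply/eqP/(mulfI (lt0r_neq0 NR)).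
  rewrite sum_label_freq EI mulrCA divff ?lt0r_neq0// mulr1 -card_bin.
  by apply: eq_bigr => i _; rewrite !inE.
rewrite mass_bin_lab mass_bin mulr_suml.
rewrite [X in _ < X](_ : _ = N%:R * \sum_(y in [set y | 0 < a y]) a y); last first.
  by rewrite [in RHS]sumrB mulrBr sum_label_freq EI sumrB sumr_const [in RHS]mulr_natl.
have sN : 0 < Num.sqrt N%:R :> R by rewrite sqrtr_gt0.
(* Multiplying by [N], the square of its root, turns the threshold [sqrt (L / 2) / sqrt N] on
   frequencies into [sqrt (N * (L / 2))] on counts. *)
move: dev; rewrite /l1_dev (sum_norm_eq2_sum_pos suma) -mulrA ltr_pM2l//.
rewrite mulrC ltr_pdivrMr// => dev.
rewrite sqrtrM ?ler0n// [L / 2]mulrC -[X in _ < X * _](sqr_sqrtr (ltW NR)) expr2.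
by rewrite -mulrA -/(num_in_bin c m) -/N ltr_pM2l// [ltRHS]mulrC.
Qed.

Lemma all_bins_deviation_bound n (L : R) : 0 <= L ->
  \sum_(c : {ffun 'I_n -> J * V} | ~~ [forall m, (0 < num_in_bin c m)%N ==>
     (\sum_y mu (m, y) != 0) &&
     (l1_dev c m <= 2 / Num.sqrt (num_in_bin c m)%:R * Num.sqrt (2^-1 * L))])
    \prod_i mu (c i) <= #|J|%:R * 2 ^+ #|V| * expR (- L).
Proof.
move=> L_ge0.
have -> : #|J|%:R * 2 ^+ #|V| * expR (- L) = \sum_(m : J) 2 ^+ #|V| * expR (- L).
  by rewrite sumr_const -mulrA -[RHS]mulr_natl.
apply: le_trans (ler_sum _ (fun m _ => bin_deviation_bound n m L_ge0)).
apply: sum_union_bound => [c|c]; first exact: prodr_ge0.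
rewrite negb_forall => /existsP[m]; rewrite negb_imply negb_and negbK -ltNge => mbad.
by exists m.
Qed.

(** The pooled law is the average of the laws [label_prob m] weighted by the relative masses of the
    bins, so the triangle inequality suffices. The set [S] will be the bins sharing the empirical
    vector [z]. *)
Lemma pooled_dev_le (S : pred J) (z : V -> R) (r : R) :
  (exists m, S m) -> (forall m, S m -> \sum_y mu (m, y) != 0) ->
  (forall m, S m -> \sum_y `|z y - label_prob m y| <= r) ->
  \sum_y `|(\sum_(m | S m) mu (m, y)) / (\sum_(m | S m) \sum_y' mu (m, y')) - z y| <= r.
Proof.
move=> [m0 Sm0] d_neq0 dev_le.
pose d m := \sum_y mu (m, y).
have d_ge0 m : 0 <= d m by exact: sumr_ge0.
set D := \sum_(m | S m) \sum_y' mu (m, y').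
have D_gt0 : 0 < D.
  rewrite /D (bigD1 m0)//=; apply: ltr_pwDl; first by rewrite lt0r d_neq0//= d_ge0.
  by apply: sumr_ge0 => m _; exact: d_ge0.
apply: (@le_trans _ _ (\sum_y \sum_(m | S m) d m / D * `|z y - label_prob m y|)).
  apply: ler_sum => y _.
  have -> : (\sum_(m | S m) mu (m, y)) / D - z y =
      - \sum_(m | S m) d m / D * (z y - label_prob m y).
    transitivity (\sum_(m | S m) mu (m, y) / D - \sum_(m | S m) d m / D * z y).
      by rewrite -!mulr_suml -/D divff ?mul1r// lt0r_neq0.
    rewrite -sumrB -sumrN; apply: eq_bigr => m Sm.
    have := d_neq0 _ Sm; rewrite /label_prob -/(d m) => dm.
    by field; rewrite dm lt0r_neq0.
  rewrite normrN; apply: le_trans (ler_norm_sum _ _ _) _.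
  by apply: ler_sum => m _; rewrite normrM ger0_norm// divr_ge0// ltW.
rewrite exchange_big/=.
apply: (@le_trans _ _ (\sum_(m | S m) d m / D * r)).
  by apply: ler_sum => m Sm; rewrite -mulr_sumr ler_wpM2l ?dev_le// divr_ge0// ltW.
by rewrite -!mulr_suml divff ?mul1r// lt0r_neq0.
Qed.
End BinFrequencies.
End FiniteConcentration.

(** * From the probability space to finite weights *)

Local Open Scope classical_set_scope.

(** An event that depends on a finite-valued map is a finite disjoint union of its fibres. *)
Lemma probR_pred_fintype (R : realType) d (Omega : measurableType d)
  (Q : probability Omega R) (T : finType) (Z : Omega -> T) (P : pred T) :
  (forall t, measurable [set w | Z w = t]) ->
  measurable [set w | P (Z w)] /\
  probR Q [set w | P (Z w)] = \sum_(t | P t) probR Q [set w | Z w = t].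
Proof.
move=> mZ; pose r := [seq t <- index_enum T | P t].
have -> : [set w | P (Z w)] = \bigcup_(t in [set` r]) [set w | Z w = t].
  apply/seteqP; split => [w /= PZ|w [t /=]]; last by rewrite mem_filter => /andP[? _] ->.
  by exists (Z w) => //=; rewrite mem_filter PZ mem_index_enum.
split; first exact: fin_bigcup_measurable.
rewrite /probR measure_fin_bigcup//; last first.
  apply/trivIsetP => i j _ _ /eqP ij; apply/seteqP; split => // w /= [Zi Zj].
  by case: ij; rewrite -Zi -Zj.
rewrite -fsbig_seq ?filter_uniq ?index_enum_uniq// big_filter sum_fine//.
by move=> t _; exact: fin_num_measure.
Qed.

(** * The joint law of bins and labels *)

Section Calibration.
Context (R : realType) (dO : measure_display) (Omega : measurableType dO)
  (Q : probability Omega R) (dX : measure_display) (TX : measurableType dX)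
  (K M n : nat) (g : TX -> 'I_M).
Hypothesis mg : forall m, measurable [set x | g x = m].

Lemma measurable_bin_label (X : Omega -> TX) (Y : Omega -> 'I_K) (t : 'I_M * 'I_K) :
  measurable_fun setT X -> (forall y, measurable [set w | Y w = y]) ->
  measurable [set w | (g (X w), Y w) = t].
Proof.
case: t => m y mX mY.
have -> : [set w | (g (X w), Y w) = (m, y)] =
    ([set: Omega] `&` X @^-1` [set x | g x = m]) `&` [set w | Y w = y].
  by apply/seteqP; split => w /= => [[-> ->]|[[_ ->] ->]].
by apply: measurableI; [exact: mX | exact: mY].
Qed.

Context (Xs : 'I_n -> Omega -> TX) (Ys : 'I_n -> Omega -> 'I_K)
  (X : Omega -> TX) (Y : Omega -> 'I_K).
Hypotheses (mXs : forall i, measurable_fun setT (Xs i))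
  (mYs : forall i y, measurable [set w | Ys i w = y])
  (mX : measurable_fun setT X) (mY : forall y, measurable [set w | Y w = y])
  (iid : iid_pairs Q (extend_rv Xs X) (extend_rv Ys Y)).

Definition bin_labels (w : Omega) : {ffun 'I_n -> 'I_M * 'I_K} :=
  [ffun i => (g (Xs i w), Ys i w)].

(** Taken from the test pair; identical distribution makes it the law of each calibration pair as
    well. *)
Definition bin_label_prob (t : 'I_M * 'I_K) : R :=
  probR Q [set w | (g (X w), Y w) = t].

Lemma measurable_bin_labels c : measurable [set w | bin_labels w = c].
Proof.
have -> : [set w | bin_labels w = c] =
    \bigcap_(i in [set: 'I_n]) [set w | (g (Xs i w), Ys i w) = c i].
  apply/seteqP; split => w /= => [<- i _|cw]; first by rewrite /= ffunE.
  by apply/ffunP => i; rewrite ffunE; exact: cw.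
apply: fin_bigcap_measurable => // i _.
exact: (measurable_bin_label (c i) (mXs i) (mYs i)).
Qed.

Lemma probR_bin_labels c :
  probR Q [set w | bin_labels w = c] = \prod_i bin_label_prob (c i).
Proof.
(* The test index [ord_max] gets the whole space, so its factor in the product rule is 1. *)
pose A (j : 'I_n.+1) : set TX :=
  if unlift ord_max j is Some i then [set x | g x = (c i).1] else setT.
pose C (j : 'I_n.+1) : set 'I_K :=
  if unlift ord_max j is Some i then [set (c i).2] else setT.
have mA j : measurable (A j) by rewrite /A; case: unliftP => [i _|_] //; exact: mg.
have [prod_rule same_law] := iid.
transitivity (probR Q [set w | forall j,
  A j (extend_rv Xs X j w) /\ C j (extend_rv Ys Y j w)]).
  congr probR; apply/seteqP; split => w /= => [cw j|cw].
    by rewrite /A /C /extend_rv -cw; case: unliftP => [i _|_] //=; rewrite ffunE.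
  apply/ffunP => i; rewrite ffunE; have {cw} := cw (lift ord_max i).
  by rewrite /A /C /extend_rv liftK/= => -[-> ->]; case: (c i).
rewrite prod_rule// (bigD1_ord ord_max)//=.
rewrite [X in X * _](_ : _ = 1) ?mul1r; last first.
  rewrite /A /C /extend_rv unlift_none.
  rewrite [X in probR _ X](_ : _ = setT) ?/probR ?probability_setT//.
  by apply/seteqP; split.
apply: eq_bigr => i _; rewrite (same_law _ ord_max)// /A /C /extend_rv liftK unlift_none.
congr probR; apply/seteqP; split => w /= => [[-> ->]|<-//].
by case: (c i).
Qed.

Lemma bin_label_prob_ge0 t : 0 <= bin_label_prob t.
Proof. by rewrite /bin_label_prob /probR fine_ge0. Qed.

Lemma probR_bin_label (P : pred ('I_M * 'I_K)) :
  probR Q [set w | P (g (X w), Y w)] = \sum_(t | P t) bin_label_prob t.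
Proof.
by have [_ ->] := @probR_pred_fintype R _ Omega Q _ (fun w => (g (X w), Y w)) P
  (fun t => measurable_bin_label t mX mY).
Qed.

Lemma sum_bin_label_prob : \sum_t bin_label_prob t = 1.
Proof.
rewrite -(probR_bin_label predT) [X in probR _ X](_ : _ = setT).
  by rewrite /probR probability_setT.
by apply/seteqP; split.
Qed.

(** Stated for unions of bins: a single bin gives [piPbin], and a level set of the recalibrated
    predictor gives the second claim. *)
Lemma condprobR_bins (S : pred 'I_M) (y : 'I_K) :
  condprobR Q [set w | Y w = y] [set w | S (g (X w))] =
  (\sum_(m | S m) bin_label_prob (m, y)) /
  (\sum_(m | S m) \sum_y' bin_label_prob (m, y')).
Proof.
rewrite /condprobR; congr (_ / _).
  pose P (t : 'I_M * 'I_K) := S t.1 && (t.2 == y).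
  transitivity (probR Q [set w | P (g (X w), Y w)]).
    congr probR; apply/seteqP; rewrite /P; split => w /= => [[-> ->]|/andP[? /eqP]//].
    by rewrite eqxx andbT.
  transitivity (\sum_(m | S m) \sum_(y' | y' == y) bin_label_prob (m, y')).
    by rewrite probR_bin_label pair_big/=; apply: eq_big => [|[]].
  by apply: eq_bigr => m _; rewrite big_pred1_eq.
rewrite pair_big_dep/= (probR_bin_label (fun t => S t.1)).
by apply: eq_big => [t|[]]//=; rewrite andbT.
Qed.

Lemma piPbinE m y : piPbin Q g X Y m y = label_prob bin_label_prob m y.
Proof.
rewrite /piPbin [X in condprobR _ _ X](_ : _ = [set w | (pred1 m) (g (X w))]).
  by rewrite condprobR_bins !big_pred1_eq.
by apply/seteqP; split => w /= /eqP.
Qed.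

Lemma bin_countE m w : bin_count g Xs m w = num_in_bin (bin_labels w) m.
Proof. by apply: eq_card => i; rewrite !inE ffunE; apply/asboolP/idP. Qed.

Lemma pihatE w m y : pihat g Xs Ys w m y = label_freq R (bin_labels w) m y.
Proof.
rewrite /pihat bin_countE; congr (_%:R / _); apply: eq_card => i.
rewrite !inE ffunE xpair_eqE andbC; exact/asboolP/idP.
Qed.
End Calibration.

(** * Both claims on one calibration event *)

Theorem theorem3 (R : realType)
  (dO : measure_display) (Omega : measurableType dO) (Q : probability Omega R)
  (dX : measure_display) (TX : measurableType dX)
  (K M n : nat)
  (f : TX -> ('I_K -> R)) (hf : forall x, @simplex R K (f x))
  (B : 'I_M -> set ('I_K -> R))
  (hBdisj : forall m m', m != m' -> B m `&` B m' = set0)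
  (hBcover : \bigcup_(m in [set: 'I_M]) B m = @simplex R K)
  (hBmeas : forall m, measurable (f @^-1` B m))
  (g : TX -> 'I_M) (hg : forall x m, g x = m <-> B m (f x))
  (Xs : 'I_n -> Omega -> TX) (Ys : 'I_n -> Omega -> 'I_K)
  (X : Omega -> TX) (Y : Omega -> 'I_K)
  (hXs : forall i, measurable_fun setT (Xs i))
  (hYs : forall i y, measurable [set w | Ys i w = y])
  (hX : measurable_fun setT X)
  (hY : forall y, measurable [set w | Y w = y])
  (hiid : iid_pairs Q (extend_rv Xs X) (extend_rv Ys Y))
  (alpha : R) (ha0 : 0 < alpha) (ha1 : alpha < 1) :
  let eps (w : Omega) (m : 'I_M) := eps_bin M K alpha (bin_count g Xs m w) in
  let h (w : Omega) (x : TX) : 'I_K -> R := pihat g Xs Ys w (g x) in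
  (exists E : set Omega, measurable E /\ ((1 - alpha)%:E <= Q E)%E /\
     forall w, E w -> forall m : 'I_M,
       ((\sum_(y < K) `|pihat g Xs Ys w m y - piPbin Q g X Y m y|)%:E <= eps w m)%E)
  /\
  (exists E : set Omega, measurable E /\ ((1 - alpha)%:E <= Q E)%E /\
     forall w, E w -> forall z : 'I_K -> R, (exists x, h w x = z) ->
       ((\sum_(y < K)
           `|condprobR Q [set w' | Y w' = y] [set w' | h w (X w') = z] - z y|)%:E
        <= \big[Order.max/-oo%E]_(m < M) eps w m)%E).
Proof.
move=> eps h.
have mg m : measurable [set x | g x = m].
  by rewrite [X in measurable X](_ : _ = f @^-1` B m)//; apply/seteqP; split => x /= /hg.
(* A probability space is nonempty, and the bin of a sample point then forces [M > 0]. *)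
have [w0 _] : [set: Omega] !=set0.
  apply/set0P/eqP => /(congr1 Q); rewrite measure0 probability_setT => /eqP.
  by rewrite onee_eq0.
have M_gt0 : (0 < M)%N by apply: leq_ltn_trans (ltn_ord (g (X w0))).
have MK_ge1 : 1 <= M%:R * 2 ^+ K :> R.
  by rewrite -natrX -natrM ler1n muln_gt0 M_gt0 expn_gt0.
have arg_gt0 : 0 < M%:R * 2 ^+ K / alpha by rewrite divr_gt0// (lt_le_trans ltr01).
pose L := ln (M%:R * 2 ^+ K / alpha).
have L_ge0 : 0 <= L.
  by rewrite /L ln_ge0// ler_pdivlMr// mul1r (le_trans (ltW ha1)).
pose mu := bin_label_prob Q g X Y.
have mu_ge0 t : 0 <= mu t by exact: bin_label_prob_ge0.
have mu_sum1 : \sum_t mu t = 1 by exact: sum_bin_label_prob.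
pose thr k : R := 2 / Num.sqrt k%:R * Num.sqrt (2^-1 * L).
(* Both claims will hold on this event; empty bins are exempt because their threshold is
   infinite. *)
pose good (c : {ffun 'I_n -> 'I_M * 'I_K}) := [forall m, (0 < num_in_bin c m)%N ==>
  (\sum_y mu (m, y) != 0) && (l1_dev mu c m <= thr (num_in_bin c m))].
pose Z := bin_labels g Xs Ys.
have mZ c : measurable [set w | Z w = c] by exact: measurable_bin_labels.
have [mE _] := probR_pred_fintype Q good mZ.
have [mbad Qbad] := probR_pred_fintype Q (fun c => ~~ good c) mZ.
have E_prob : ((1 - alpha)%:E <= Q [set w | good (Z w)])%E.
  have -> : [set w | good (Z w)] = ~` [set w | ~~ good (Z w)].
    by apply/seteqP; split => w /=; [move=> gw; rewrite gw | move=> /negP; rewrite negbK].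
  rewrite probability_setC// EFinB leeB// -[leLHS]fineK ?fin_num_measure// lee_fin.
  rewrite -/(probR Q _) Qbad.
  under eq_bigr do rewrite (probR_bin_labels mg hiid).
  apply: le_trans (all_bins_deviation_bound mu_ge0 mu_sum1 n L_ge0) _.
  (* Here [expR (- L) = alpha / (M * 2 ^+ K)], so the union bound is exactly [alpha]. *)
  rewrite !card_ord expRN lnK ?posrE// invf_div mulrC divfK//.
  by rewrite lt0r_neq0// (lt_le_trans ltr01).
have epsE w m : good (Z w) ->
    ((l1_dev mu (Z w) m)%:E <= eps w m)%E /\
    (eps w m = +oo%E \/ \sum_y mu (m, y) != 0).
  move=> /forallP/(_ m); rewrite /eps /eps_bin (bin_countE g Xs Ys).
  case: posnP => [_ _|N_gt0 /=].
    by rewrite leey; split=> //; left.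
  by move=> /andP[? ?]; rewrite lee_fin; split => //; right.
have devE w m : \sum_y `|pihat g Xs Ys w m y - piPbin Q g X Y m y| = l1_dev mu (Z w) m.
  by apply: eq_bigr => y _; rewrite pihatE piPbinE.
split; exists [set w | good (Z w)]; do 2!split=> //; move=> w /= Ew.
  by move=> m; rewrite devE; have [] := epsE w m Ew.
move=> z [x hz].
set e := (\big[Order.max/-oo]_(m < M) eps w m)%E.
have eps_le m : (eps w m <= e)%E by exact: le_bigmax.
pose S m := `[< pihat g Xs Ys w m = z >].
have dev_le m : ((l1_dev mu (Z w) m)%:E <= e)%E.
  by have [dev _] := epsE w m Ew; exact: le_trans (eps_le m).
(* An empty bin makes the maximum infinite and the claim trivial; otherwise every bin is nonempty,
   hence of nonzero mass. *)
have [[m em]|eps_fin] := pselect (exists m, eps w m = +oo%E).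
  by apply: le_trans (eps_le m); rewrite em leey.
have d_neq0 m : \sum_y mu (m, y) != 0.
  by have [_ [em|//]] := epsE w m Ew; case: eps_fin; exists m.
(* The calibration outcome [w] is frozen, so a level set of [h w] is a union of bins. *)
have SE : [set w' | h w (X w') = z] = [set w' | S (g (X w'))].
  by apply/seteqP; split => w' /= /asboolP.
under eq_bigr do rewrite SE condprobR_bins//.
(* The value [-oo] is excluded by the real-valued deviation of the bin [g x]. *)
case: e dev_le {eps_le} => [r|_|/(_ (g x))//]; last exact: leey.
move=> dev_le; rewrite lee_fin; apply: pooled_dev_le => //.
  by exists (g x); apply/asboolP.
move=> m /asboolP zm; rewrite -lee_fin; apply: le_trans (dev_le m).
by rewrite lee_fin -devE -zm; apply: ler_sum => y _; rewrite piPbinE.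
Qed.
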